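(* Let $D$ be any DAG, with essential graph $\mathcal{E}(D)$, and let $m(D)$ be the minimum size of a verifying intervention set for $D$. Then $$m(D)\ \ge\ \sum_{G\in\mathtt{CC}(\mathcal{E}(D))}\left\lfloor\frac{\omega(G)}{2}\right\rfloor,$$ where $\mathtt{CC}(\mathcal{E}(D))$ is the set of chain components of $\mathcal{E}(D)$ and $\omega(G)$ is the size of the largest clique of $G$.
   Context: All graphs are finite. Two DAGs are Markov equivalent if the same positive distributions are Markov to both (equivalently, same skeleton and same v-structures); $[D]$ is the Markov equivalence class of $D$. The essential graph $\mathcal{E}(D)$ has the same skeleton as $D$, with $i\to j$ if $i\to j$ in every $D'\in[D]$, and an undirected edge otherwise. The chain components $\mathtt{CC}(\mathcal{E}(D))$ are the connected components of the undirected graph obtained from $\mathcal{E}(D)$ by removing its directed edges. A single-node intervention is given by its target $v\in V(D)$. For a set $\mathcal{I}$ of single-node interventions, $[D]_{\mathcal I}$ is the set of DAGs in $[D]$ that agree with $D$ on the orientation of every edge incident to a node of $\mathcal{I}$; the $\mathcal{I}$-essential graph $\mathcal{E}_{\mathcal I}(D)$ has the skeleton of $D$, with $i\to j$ iff $i\to j$ in all $D'\in[D]_{\mathcal I}$, and undirected edges otherwise. A verifying intervention set (VIS) for $D$ is a set $\mathcal{I}\subseteq V(D)$ of single-node interventions with $\mathcal{E}_{\mathcal I}(D)=D$. $m(D)$ is the minimum cardinality of a VIS for $D$. *)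

(* Defs.v *)
(* Libraries: MathComp, with classical logic and the real numbers of
   MathComp-Analysis. *)
From mathcomp Require Import all_boot all_order all_algebra.
From mathcomp Require Import boolp reals.

Set Implicit Arguments.
Unset Strict Implicit.
Unset Printing Implicit Defensive.

Import Order.TTheory GRing.Theory Num.Theory.

Local Open Scope ring_scope.

Section Graphs.
Context {V : finType}.

(* (i, j) \in D is the arc i -> j. *)
Definition digraph : Type := {set V * V}.

Implicit Types (D : digraph) (I K : {set V}).

(* No arc i -> j lies on a directed cycle; since connect is reflexive, this
   also excludes loops. *)
Definition acyclic D : bool :=
  [forall e in D, ~~ connect [rel i j | (i, j) \in D] e.2 e.1].

Definition parents D (v : V) : {set V} := [set u | (u, v) \in D].

(* An undirected edge is represented by its two ordered pairs. *)
Definition skeleton D : {set V * V} :=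
  [set e | (e \in D) || ((e.2, e.1) \in D)].

Record mixed_graph : Type := MixedGraph {
  directed : {set V * V};
  undirected : {set V * V}
}.

Definition mixed_of_digraph D : mixed_graph := MixedGraph D set0.

(* The graph with the skeleton of D in which exactly the edges oriented the
   same way by all the members of C are directed. *)
Definition common_graph D (C : {set digraph}) : mixed_graph :=
  let dir := [set e in skeleton D | [forall D' in C, e \in D']] in
  MixedGraph dir
    [set e in skeleton D | (e \notin dir) && ((e.2, e.1) \notin dir)].

Definition undirected_adj (H : mixed_graph) : rel V :=
  [rel i j | (i, j) \in undirected H].

Definition chain_components (H : mixed_graph) : {set {set V}} :=
  equivalence_partition (connect (undirected_adj H)) [set: V].

Definition clique (adj : rel V) K : bool :=
  [forall i in K, forall j in K, (i != j) ==> adj i j].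

(* Clique number of the subgraph of adj induced on G. *)
Definition clique_number (adj : rel V) (G : {set V}) : nat :=
  \max_(K : {set V} | (K \subset G) && clique adj K) #|K|.

End Graphs.

Arguments digraph V : clear implicits.
Arguments mixed_graph V : clear implicits.

Section MarkovEquivalence.
Context (R : realType) {V : finType}.

Implicit Types (D : digraph V) (I : {set V}).

(* The joint distributions are those of a family of random variables indexed
   by V, the one at v taking its values in the finite set T v. *)
Definition positive_distribution (T : V -> finType)
    (p : {dffun forall v, T v} -> R) : Prop :=
  (forall x, 0 < p x) /\ \sum_x p x = 1.

Definition marginal (T : V -> finType) (p : {dffun forall v, T v} -> R)
    (S : {set V}) (x : {dffun forall v, T v}) : R :=
  \sum_(y : {dffun forall v, T v} | [forall v in S, y v == x v]) p y.

Definition conditional (T : V -> finType) (p : {dffun forall v, T v} -> R)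
    (v : V) (S : {set V}) (x : {dffun forall v, T v}) : R :=
  marginal p (v |: S) x / marginal p S x.

Definition markov_to (T : V -> finType) (p : {dffun forall v, T v} -> R)
    D : Prop :=
  forall x, p x = \prod_(v : V) conditional p v (parents D v) x.

Definition markov_equiv D D' : Prop :=
  forall (T : V -> finType) (p : {dffun forall v, T v} -> R),
    positive_distribution p -> (markov_to p D <-> markov_to p D').

Definition markov_class D : {set digraph V} :=
  [set D' : digraph V | acyclic D' && `[< markov_equiv D D' >]].

Definition interventional_class D I : {set digraph V} :=
  [set D' in markov_class D |
    [forall e : V * V, ((e.1 \in I) || (e.2 \in I)) ==>
       ((e \in D') == (e \in D))]].

Definition essential_graph D : mixed_graph V :=
  common_graph D (markov_class D).

Definition interventional_essential_graph D I : mixed_graph V :=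
  common_graph D (interventional_class D I).

Definition verifying D I : Prop :=
  interventional_essential_graph D I = mixed_of_digraph D.

(* The default value [set: V] is itself verifying; see verifying_setT. *)
Definition min_verifying_size D : nat :=
  #|[arg min_(I < [set: V] | `[< verifying D I >]) #|I|]|.

Lemma markov_class_refl D : acyclic D -> D \in markov_class D.
Proof. by move=> hD; rewrite inE hD; apply/asboolP => T p _. Qed.

Lemma verifying_setT D : acyclic D -> verifying D [set: V].
Proof.
move=> hD.
have DC : D \in interventional_class D [set: V].
  by rewrite inE markov_class_refl //=; apply/forallP => e; rewrite eqxx implybT.
have dirE : [set e in skeleton D |
    [forall D' in interventional_class D [set: V], e \in D']] = D.
  apply/setP => e; rewrite !inE; apply/andP/idP => [[_ /forallP/(_ D)]|eD].
    by rewrite DC.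
  split; first by rewrite eD.
  apply/forallP => D'; apply/implyP; rewrite inE => /andP[_ /forallP/(_ e)].
  by rewrite !in_setT /= => /eqP->.
rewrite /verifying /interventional_essential_graph /common_graph dirE.
congr MixedGraph; apply/setP => e; rewrite !inE.
by case: (e \in D); case: (_ \in D).
Qed.

Lemma min_verifying_sizeP D : acyclic D ->
  (exists2 I, verifying D I & #|I| = min_verifying_size D) /\
  (forall I, verifying D I -> (min_verifying_size D <= #|I|)%N).
Proof.
move=> hD; rewrite /min_verifying_size; case: arg_minnP.
  by apply/asboolP; exact: verifying_setT.
move=> I /asboolP vI minI; split; first by exists I.
by move=> J /asboolP /minI.
Qed.

End MarkovEquivalence.

(* Main.v *)
Require Import Defs.
From mathcomp Require Import all_boot all_order all_algebra.
From mathcomp Require Import boolp reals.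
From mathcomp Require Import zify ring lra.

(* A covered arc x -> y of D (the parents of y are x and the parents of x) can
   be reversed within the Markov equivalence class, so every verifying set
   contains x or y. In a chain component, the undirected parents of a vertex v
   form a clique, so all of them but the last one, q, are undirected parents of
   q. Hence the number of undirected parents grows by at most one along q -> v,
   and q -> v is covered when it does grow. Walking up in this way from the last
   vertex of a clique with w vertices, one crosses at least w - 1 covered arcs
   of a path inside the component, and w / 2 vertices are needed to cover them.

   The structure of chain components comes from two facts. First, Markov
   equivalent DAGs have the same skeleton and the same v-structures: the
   distribution of fair coins whose parity over A is slightly biased is Markov
   to D iff some v in A has all of A \ v as parents, which determines both.
   Second, the compelled arcs are those obtained by Meek's rules. Any edge left
   over can be oriented both ways, because an elimination order of the chordal
   graph of these edges can be chosen to end with the edge in either order, and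
   the resulting DAG is reached from D by reversals of covered arcs. *)

Set Implicit Arguments.
Unset Strict Implicit.
Unset Printing Implicit Defensive.

Import Order.TTheory GRing.Theory Num.Theory.

(** * Acyclicity, skeletons and v-structures *)

Section Acyclicity.
Context {V : finType}.
Implicit Types (D : digraph V) (f : V -> nat).

Definition topo_rank D f := forall u v, (u, v) \in D -> f u < f v.

(** The rank of a vertex is the number of its ancestors, itself included. *)
Lemma acyclic_topo_rank D : acyclic D -> exists f, topo_rank D f.
Proof.
move=> /forallP hD; pose e := [rel i j | (i, j) \in D].
exists (fun v => #|[set u | connect e u v]|) => u v uv.
apply: proper_card; apply/properP; split.
  by apply/subsetP => w; rewrite !inE => /connect_trans; apply; exact: connect1.
exists v; rewrite !inE ?connect0 //.
by have /implyP := hD (u, v); apply.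
Qed.

Lemma topo_rank_acyclic D f : topo_rank D f -> acyclic D.
Proof.
move=> hf; apply/forallP => -[u v]; apply/implyP => /= uv.
apply/negP => /connectP[p pth lst].
have : f v <= f (last v p).
  elim: p v pth {uv lst} => //= w p IH v /andP[vw /IH]; apply: leq_trans.
  exact/ltnW/hf.
by rewrite -lst leqNgt hf.
Qed.

End Acyclicity.

Section Skeleton.
Context {V : finType}.
Implicit Types (D : digraph V).

Definition adj D : rel V := [rel i j | ((i, j) \in D) || ((j, i) \in D)].

Definition vstruct D a b c :=
  [&& (a, b) \in D, (c, b) \in D, a != c & ~~ adj D a c].

Definition same_skeleton_vstruct D D' :=
  (forall i j, adj D i j = adj D' i j) /\
  (forall a b c, vstruct D a b c = vstruct D' a b c).

Definition clustered D (A : {set V}) :=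
  [exists v in A, A :\ v \subset parents D v].

Lemma adjC D i j : adj D i j = adj D j i.
Proof. by rewrite /adj /= orbC. Qed.

Lemma clustered2 D i j : i != j -> clustered D [set i; j] = adj D i j.
Proof.
move=> ij; apply/exists_inP/orP => [[v]|].
  rewrite !inE => /orP[] /eqP-> /subsetP h; [right|left].
    by have := h j; rewrite !inE eqxx orbT eq_sym ij; apply.
  by have := h i; rewrite !inE eqxx ij; apply.
case=> h; [exists j|exists i]; rewrite ?inE ?eqxx ?orbT //; apply/subsetP => w;
  by rewrite !inE => /andP[/negPf->]; rewrite ?orbF /= => /eqP->.
Qed.

Lemma vstruct_clustered D a b c : a != b -> c != b ->
  vstruct D a b c = [&& clustered D [set a; b; c], a != c & ~~ adj D a c].
Proof.
move=> ab cb; rewrite /vstruct.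
have [->|ac] /= := eqVneq a c; first by rewrite !andbF.
case: (boolP (adj D a c)) => /= [|nadj]; rewrite ?andbF // !andbT.
apply/andP/exists_inP => [[h1 h2]|[v]].
  exists b; rewrite ?inE ?eqxx ?orbT //; apply/subsetP => w.
  by rewrite !inE => /andP[/negPf->] /=; rewrite ?orbF => /orP[]/eqP->.
rewrite !inE => /orP[/orP[]|] /eqP-> /subsetP h.
- by have := h c; rewrite !inE eqxx orbT eq_sym ac => /(_ isT) E;
  rewrite /adj /= E orbT in nadj.
- by split; [have := h a|have := h c]; rewrite !inE eqxx ?orbT ?ab ?cb; apply.
- by have := h a; rewrite !inE eqxx ac => /(_ isT) E; rewrite /adj /= E in nadj.
Qed.

End Skeleton.

(** * Markov equivalence determines skeleton and v-structures *)

Section Parity.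
Context (R : realType) {V : finType}.
Implicit Types (D : digraph V) (A S : {set V}).
Local Open Scope ring_scope.

Definition bits : V -> finType := fun=> bool.
Local Notation X := {dffun forall v, bits v}.

Definition flip (k : V) (x : X) : X :=
  finfun (fun v => if v == k then ~~ x v else x v : bits v).

Lemma flipK k : involutive (flip k).
Proof.
by move=> x; apply/ffunP => v; rewrite !ffunE; case: eqP => // _; rewrite negbK.
Qed.

Definition parity A (x : X) : R := \prod_(v in A) (-1) ^+ (x v : bool).

Lemma parity_flip A k x : k \in A -> parity A (flip k x) = - parity A x.
Proof.
move=> kA; rewrite /parity !(bigD1 k kA) /= ffunE eqxx -mulNr; congr (_ * _).
  by case: (x k); rewrite ?expr0 ?expr1 ?opprK.
by apply: eq_bigr => v /andP[_ /negPf vk]; rewrite ffunE vk.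
Qed.

Lemma parity_sqr A x : parity A x ^+ 2 = 1.
Proof.
rewrite /parity -prodrXl big1 // => v _.
by case: (x v); rewrite ?expr0 ?expr1n // expr1 sqrrN expr1n.
Qed.

Lemma parity_eq A S (x y : X) : A \subset S -> [forall v in S, y v == x v] ->
  parity A y = parity A x.
Proof.
move=> /subsetP AS /forall_inP yx; apply: eq_bigr => v /AS /yx /eqP.
by move=> ->.
Qed.

Definition num_ext S (x : X) : R :=
  \sum_(y : X | [forall v in S, y v == x v]) 1.

Lemma agree_flip S k (x y : X) : k \notin S ->
  [forall v in S, flip k y v == x v] = [forall v in S, y v == x v].
Proof.
move=> kS; apply: eq_forallb_in => v vS; rewrite ffunE ifN //.
by apply: contraNneq kS => <-.
Qed.

Lemma num_ext_setU1 S k x : k \notin S ->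
  num_ext S x = 2 * num_ext (k |: S) x.
Proof.
move=> kS; rewrite /num_ext (bigID (fun y : X =>
  y k == x k)) /= mulr_natl mulr2n.
have E (y : X) : [forall v in k |: S, y v == x v] =
    [forall v in S, y v == x v] && (y k == x k).
  apply/forall_inP/andP => [h|[/forall_inP h hk] v].
    split; last by apply: h; rewrite !inE eqxx.
    by apply/forall_inP => v vS; apply: h; rewrite !inE vS orbT.
  by rewrite !inE => /orP[/eqP->|/h].
congr (_ + _); first by apply: eq_bigl => y; rewrite E.
rewrite [LHS](reindex_inj (inv_inj (flipK k))) /=; apply: eq_bigl => y.
rewrite E agree_flip // ffunE eqxx; congr (_ && _).
by case: (y k); case: (x k).
Qed.

Lemma num_ext_gt0 S x : 0 < num_ext S x.
Proof.
rewrite /num_ext (bigD1 x) /=; last by apply/forall_inP.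
by rewrite ltr_pwDl // sumr_ge0.
Qed.

Lemma num_ext0 x : num_ext set0 x = 2 ^+ #|V|.
Proof.
rewrite /num_ext (eq_bigl predT) => [|y]; last by apply/forall_inP => v;
  rewrite inE.
rewrite sumr_const card_dep_ffun -natrX; congr (_%:R).
rewrite cardE /image_mem; elim: (enum V) => //= v s ->.
by rewrite card_bool expnS.
Qed.

(** On the summation range the parity is constant if [S] contains [A]; otherwise flipping a coin of
    [A] outside [S] pairs terms of opposite signs. *)
Lemma sum_parity A S (x : X) :
  \sum_(y : X | [forall v in S, y v == x v]) parity A y =
  num_ext S x * (A \subset S)%:R * parity A x.
Proof.
case: (boolP (A \subset S)) => [AS|/subsetPn[k kA kS]].
  rewrite mulr1 /num_ext mulr_suml; apply: eq_bigr => y yx.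
  by rewrite mul1r (parity_eq AS yx).
rewrite mulr0 mul0r; set s := LHS.
suff : s = - s by move=> E; lra.
rewrite /s [LHS](reindex_inj (inv_inj (flipK k))) /= -sumrN.
apply: eq_big => y; first by rewrite agree_flip.
by rewrite parity_flip.
Qed.

(** The parity takes the values 1 and -1, so the factor [2^-1] keeps all probabilities positive. *)
Definition parity_dist A (x : X) : R :=
  (2 ^+ #|V|)^-1 * (1 + 2^-1 * parity A x).

Lemma marginal_parity_dist A S x :
  marginal (parity_dist A) S x =
  num_ext S x * ((2 ^+ #|V|)^-1 * (1 + 2^-1 * (A \subset S)%:R * parity A x)).
Proof.
rewrite /marginal /parity_dist -mulr_sumr big_split /= -mulr_sumr sum_parity.
rewrite -/(num_ext S x); ring.
Qed.

Lemma parity_itv A x : -1 <= parity A x <= 1.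
Proof. by rewrite -ler_norml -(@expr_le1 _ 2%N) // -normrX parity_sqr normr1.
  Qed.

Lemma parity_factor_gt0 A x (b : bool) : 0 < 1 + 2^-1 * b%:R * parity A x.
Proof. by have /andP[? ?] := parity_itv A x; case: b; rewrite ?mulr1 ?mulr0;
  lra. Qed.

Lemma parity_dist_positive A : A != set0 ->
  positive_distribution (parity_dist A).
Proof.
move=> A0; split=> [x|].
  rewrite mulr_gt0 ?invr_gt0 ?exprn_gt0 //.
  by have := parity_factor_gt0 A x true; rewrite mulr1.
pose x0 : X := finfun (fun v => true : bits v).
transitivity (marginal (parity_dist A) set0 x0).
  by apply: eq_bigl => y; apply/esym/forall_inP => v; rewrite inE.
rewrite marginal_parity_dist num_ext0 subset0 (negPf A0) mulr0 mul0r addr0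
  mulr1.
by rewrite divff // expf_neq0 // pnatr_eq0.
Qed.

(** The bias survives in the numerator iff [A \subset v |: S], and in the denominator iff
    [A \subset S]. For [v] outside [A] these agree and cancel; for [v] in [A] the second fails. *)
Lemma conditional_parity_dist A v S x : v \notin S ->
  conditional (parity_dist A) v S x =
  2^-1 * (if (v \in A) && (A :\ v \subset S) then 1 + 2^-1 * parity A x else 1).
Proof.
move=> vS; rewrite /conditional !marginal_parity_dist (num_ext_setU1 x vS).
have g0 := num_ext_gt0 (v |: S) x.
have p0 : (2 : R) ^+ #|V| != 0 by rewrite expf_neq0 // pnatr_eq0.
have n0 := lt0r_neq0 g0.
pose g (b : bool) : R := 1 + 2^-1 * b%:R * parity A x.
have ratio b c : num_ext (v |: S) x * ((2 ^+ #|V|)^-1 * g b) /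
    (2 * num_ext (v |: S) x * ((2 ^+ #|V|)^-1 * g c)) = 2^-1 * (g b / g c).
  move: (lt0r_neq0 (parity_factor_gt0 A x c)) p0 n0; rewrite -/(g c).
  by move: (_ ^+ _) (g b) (g c) (num_ext _ _) => N y z k z0 N0 k0; field;
    rewrite N0 z0 k0.
have gg b : g b / g b = 1 by rewrite divff // lt0r_neq0 ?parity_factor_gt0.
have g_0 : g false = 1 by rewrite /g mulr0 mul0r addr0.
have g_1 : g true = 1 + 2^-1 * parity A x by rewrite /g mulr1.
rewrite -!/(g _) ratio; congr (_ * _).
have E : (A \subset v |: S) = (A :\ v \subset S) by rewrite subDset.
rewrite E; case: (boolP (v \in A)) => vA /=; last first.
  rewrite (_ : A :\ v = A); last first.
    by apply/setP => w; rewrite !inE; case: (eqVneq w v) => // ->;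
      rewrite (negPf vA).
  exact: gg.
have -> : (A \subset S) = false.
  by apply/negbTE/subsetPn; exists v.
by case: (A :\ v \subset S); rewrite ?gg // g_0 divr1.
Qed.

(** The product of conditionals has one biased factor for each vertex of [A] whose parents contain
    the rest of [A]. Two such vertices would be parents of each other, so there is at most one. *)
Lemma markov_parity_dist D A : acyclic D ->
  markov_to (parity_dist A) D <-> clustered D A.
Proof.
move=> /acyclic_topo_rank[f hf].
have irr v : v \notin parents D v.
  by rewrite inE; apply/negP => /hf; rewrite ltnn.
have prodE x : \prod_(v : V) conditional (parity_dist A) v (parents D v) x =
  (2 ^+ #|V|)^-1 * \prod_(v in A | A :\ v \subset parents D v) (1 + 2^-1 *
    parity A x).
  under eq_bigr do rewrite conditional_parity_dist //.
  by rewrite big_split /= prodr_const -exprVn -big_mkcond.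
have p0 : ((2 : R) ^+ #|V|)^-1 != 0
  by rewrite invr_neq0 // expf_neq0 // pnatr_eq0.
have uniqv v w : v \in A -> w \in A -> A :\ v \subset parents D v ->
    A :\ w \subset parents D w -> v = w.
  move=> vA wA /subsetP hv /subsetP hw; apply/eqP; apply: contraT => vw.
  have := hv w; have := hw v;
    rewrite !inE vA wA (eq_sym w) vw => /(_ isT)/hf + /(_ isT)/hf.
  by move=> /ltn_trans h/h; rewrite ltnn.
split=> [h|/exists_inP[v vA hv] x].
  apply: contraT => /exists_inPn nc.
  (* With no biased factor the product is uniform, which fails at this configuration, of parity
     1. *)
  pose x0 : X := finfun (fun v => false : bits v).
  have := h x0; rewrite prodE big_pred0 => [|v]; last first.
    by case: (boolP (v \in A)) => //= /nc/negPf.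
  move=> /(mulfI p0) E; exfalso.
  have : parity A x0 = 1 by rewrite /parity big1 // => v _; rewrite ffunE.
  by move=> E1; rewrite E1 in E; lra.
rewrite prodE /parity_dist (bigD1 v) /= ?vA // big_pred0 ?mulr1 // => w.
apply/negbTE/negP => /andP[/andP[wA hw]]; apply/negP; rewrite negbK.
exact/eqP/uniqv.
Qed.

Lemma markov_equiv_clustered D D' A : acyclic D -> acyclic D' ->
  markov_equiv R D D' -> A != set0 -> clustered D A = clustered D' A.
Proof.
move=> hD hD' DD' A0; have [//|h1 h2] := DD' bits (parity_dist A).
  exact: parity_dist_positive.
have [m1 m2] := markov_parity_dist A hD.
have [m1' m2'] := markov_parity_dist A hD'.
by apply/idP/idP => [/m2/h1/m1'|/m2'/h2/m1].
Qed.

Lemma markov_equiv_same D D' : acyclic D -> acyclic D' ->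
  markov_equiv R D D' -> same_skeleton_vstruct D D'.
Proof.
move=> hD hD' DD'.
have irr E i : acyclic E -> (i, i) \in E = false.
  by move=> /acyclic_topo_rank[f hf]; apply/negP => /hf; rewrite ltnn.
have adjE i j : adj D i j = adj D' i j.
  have [->|ij] := eqVneq i j; first by rewrite /adj /= !irr.
  rewrite -!clustered2 //; apply: markov_equiv_clustered => //.
  by apply/set0Pn; exists i; rewrite !inE eqxx.
split=> // a b c.
have [->|ab] := eqVneq a b; first by rewrite /vstruct !irr.
have [->|cb] := eqVneq c b; first by rewrite /vstruct !irr ?andbF.
rewrite !vstruct_clustered // adjE; congr (_ && _).
apply: markov_equiv_clustered => //.
by apply/set0Pn; exists a; rewrite !inE eqxx.
Qed.

End Parity.

(** * Reversal of covered arcs *)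

Section CoveredArcs.
Context (R : realType) {V : finType}.
Implicit Types (D : digraph V).

Definition covered D x y :=
  ((x, y) \in D) && (parents D y == x |: parents D x).

Definition reverse_arc D x y : digraph V := (y, x) |: (D :\ (x, y)).

Lemma in_reverse_arc D x y u v : ((u, v) \in reverse_arc D x y) =
  (u == y) && (v == x) || ~~ ((u == x) && (v == y)) && ((u, v) \in D).
Proof. by rewrite !inE -!pair_eqE. Qed.

Lemma acyclic_irr D v : acyclic D -> (v, v) \in D = false.
Proof. by move=> /acyclic_topo_rank[f hf]; apply/negP => /hf; rewrite ltnn. Qed.

Lemma acyclic_asym D u v : acyclic D -> (u, v) \in D -> (v, u) \in D = false.
Proof.
move=> /acyclic_topo_rank[f hf] /hf uv; apply/negP => /hf.
by rewrite ltnNge ltnW.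
Qed.

Lemma acyclic_trans D u v w : acyclic D -> (u, v) \in D -> (v, w) \in D ->
  (w, u) \in D = false.
Proof.
move=> /acyclic_topo_rank[f hf] /hf uv /hf vw; apply/negP => /hf.
by move: uv vw; lia.
Qed.

Lemma covered_in D x y z : covered D x y ->
  ((z, y) \in D) = (z == x) || ((z, x) \in D).
Proof. by move=> /andP[_ /eqP/setP/(_ z)]; rewrite !inE. Qed.

Lemma reverse_arc_acyclic D x y : acyclic D -> covered D x y ->
  acyclic (reverse_arc D x y).
Proof.
move=> /acyclic_topo_rank[f hf] cov; have xy : (x, y) \in D by case/andP: cov.
have xNy : x != y by apply: contraTneq xy => ->; apply/negP => /hf;
  rewrite ltnn.
(* [y] takes the rank of [x], and [x] comes right after it; doubling makes room between consecutive
   ranks. *)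
pose g v := if v == y then (f x).*2 else if v == x then (f x).*2.+1 else (f
  v).*2.
apply: (@topo_rank_acyclic _ _ g) => u v; rewrite in_reverse_arc /g.
case/orP => [/andP[/eqP-> /eqP->]|/andP[ne uv]].
  by rewrite eqxx (negPf xNy) eqxx.
have fuv := hf _ _ uv; have fxy := hf _ _ xy.
have [vy|vy] := eqVneq v y.
  have := covered_in u cov; rewrite -vy uv;
    case: eqP ne => [->|ux _ /= /esym ux'].
    by rewrite vy eqxx.
  have := hf _ _ ux'; have [uy|uy] := eqVneq u v; last by lia.
  by move: fuv; rewrite uy ltnn.
have [vx|vx] := eqVneq v x.
  have [uy|uy] := eqVneq u y; first by move: fuv; rewrite uy vx; lia.
  by have [ux|ux] := eqVneq u x; move: fuv; rewrite vx ?ux; lia.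
by have [uy|uy] := eqVneq u y; [|have [ux|ux] := eqVneq u x]; move: fuv fxy;
  rewrite ?uy ?ux; lia.
Qed.

Lemma parents_reverse_arc D x y v : acyclic D -> covered D x y ->
  parents (reverse_arc D x y) v =
  if v == x then y |: parents D x else if v == y then parents D x else parents
    D v.
Proof.
move=> hD cov; have xy : (x, y) \in D by case/andP: cov.
have xNy : x != y by apply: contraTneq xy => ->; rewrite acyclic_irr.
apply/setP => u; rewrite inE in_reverse_arc.
have [->|vx] := eqVneq v x; first by rewrite !inE andbT (negPf xNy) andbF.
rewrite andbF /=; have [->|vy] := eqVneq v y; last by rewrite andbF !inE.
rewrite andbT inE (covered_in _ cov).
by have [->|] := eqVneq u x; rewrite //= acyclic_irr.
Qed.

Local Open Scope ring_scope.

Lemma marginal_gt0 (T : V -> finType) (p : {dffun forall v, T v} -> R) S x :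
  positive_distribution p -> 0 < marginal p S x.
Proof.
move=> [p0 _]; rewrite /marginal (bigD1 x) /=; last by apply/forall_inP.
by rewrite ltr_pwDl // sumr_ge0 // => y _; apply: ltW.
Qed.

(** Only the factors at [x] and [y] change. With [S] the parents of [x], both products of the two
    telescope to the marginal on [S], [x], [y] divided by that on [S]. *)
Lemma markov_equiv_reverse_arc D x y : acyclic D -> covered D x y ->
  markov_equiv R D (reverse_arc D x y).
Proof.
move=> hD cov T p hp.
have xy : (x, y) \in D by case/andP: cov.
have yNx : y != x by apply: contraTneq xy => ->; rewrite acyclic_irr.
suff E z : \prod_v conditional p v (parents D v) z =
           \prod_v conditional p v (parents (reverse_arc D x y) v) z.
  by split=> h z; rewrite h E.
rewrite (bigD1 x) //= (bigD1 y) //= [in RHS](bigD1 x) //= [in RHS](bigD1 y) //=.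
under [in RHS]eq_bigr => v /andP[/negPf vx /negPf vy].
  rewrite parents_reverse_arc // vx vy; over.
rewrite !mulrA; congr (_ * _).
rewrite !parents_reverse_arc // eqxx (negPf yNx) eqxx.
have /andP[_ /eqP->] := cov.
rewrite /conditional [x |: (y |: _)]setUCA.
have := lt0r_neq0 (marginal_gt0 (x |: parents D x) z hp).
have := lt0r_neq0 (marginal_gt0 (y |: parents D x) z hp).
have := lt0r_neq0 (marginal_gt0 (parents D x) z hp).
move: (marginal _ _ _) (marginal _ _ _) (marginal _ _ _) (marginal _ _ _).
by move=> a b c d d0 c0 b0; field; rewrite d0 c0 b0.
Qed.

End CoveredArcs.

(** * Markov equivalence from equal skeletons and v-structures *)

Section Chickering.
Context (R : realType) {V : finType}.
Implicit Types (D : digraph V).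

Lemma same_skeleton_vstruct_sym D D' : same_skeleton_vstruct D D' ->
  same_skeleton_vstruct D' D.
Proof. by move=> [h1 h2]; split. Qed.

Lemma same_skeleton_vstruct_trans D2 D1 D3 : same_skeleton_vstruct D1 D2 ->
  same_skeleton_vstruct D2 D3 -> same_skeleton_vstruct D1 D3.
Proof.
move=> [h1 h2] [h3 h4].
by split=> [i j|a b c]; rewrite ?h1 ?h2.
Qed.

(* Chickering's choice: y is the first vertex with an incoming arc on which D
   and D' disagree, and x is the last tail of such an arc into y. *)
Lemma ex_covered_arc D D' : acyclic D -> acyclic D' ->
  same_skeleton_vstruct D D' -> D :\: D' != set0 ->
  exists x y, [/\ covered D x y, (x, y) \notin D' & (y, x) \in D'].
Proof.
move=> hD hD' [sk vs] /set0Pn[[x0 y0] xy0].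
have [f hf] := acyclic_topo_rank hD.
pose P y := [exists x, (x, y) \in D :\: D'].
have Py0 : P y0 by apply/existsP; exists x0.
case: (@arg_minnP _ y0 P f Py0) => y /existsP[x1 xy1] miny.
pose Q x := (x, y) \in D :\: D'.
case: (@arg_maxnP _ x1 Q f xy1) => x; rewrite /Q inE => /andP[nxy xy] maxx.
have adjK u v : (u, v) \in D -> (u, v) \notin D' -> (v, u) \in D'.
  by move=> uv nuv; have := sk u v; rewrite /adj /= uv (negPf nuv) /= => <-.
have early u v : (u, v) \in D -> f v < f y -> (u, v) \in D'.
  move=> uv vy; apply: contraT => nuv.
  have /miny : P v by apply/existsP; exists u; rewrite inE nuv.
  by rewrite leqNgt vy.
have late u : (u, y) \in D -> f x < f u -> (u, y) \in D'.
  move=> uy xu; apply: contraT => nuy.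
  have /maxx : Q u by rewrite /Q inE nuy.
  by rewrite /= leqNgt xu.
have yx := adjK _ _ xy nxy.
exists x, y; split=> //; rewrite /covered xy /=; apply/eqP/setP => z;
  rewrite !inE.
have [->|zx] := eqVneq z x; first by rewrite xy.
have ynx : y != x by apply: contraTneq xy => ->; rewrite acyclic_irr.
apply/idP/idP => [zy|zx'] /=.
  (* If [x -> z], then [D'] has the cycle [x -> z -> y -> x]; if [z] and [x] are not adjacent, the
     v-structure at [y] forces [x -> y] in [D']. *)
  case: (boolP (adj D z x)) => [/orP[//|xz]|nzx].
    have zy' := late _ zy (hf _ _ xz).
    have xz' := early _ _ xz (hf _ _ zy).
    by have := acyclic_trans hD' xz' zy'; rewrite yx.
  have := vs z y x; rewrite /vstruct zy xy zx nzx /= => /esym/and3P[_ ].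
  by rewrite (negPf nxy).
(* Here [y -> z] would close a cycle in [D], and non-adjacency would give [D'] a v-structure at [x]
   that [D] lacks. *)
case: (boolP (adj D z y)) => [/orP[//|yz]|nzy].
  by have := acyclic_trans hD yz zx'; rewrite xy.
have zx2 := early _ _ zx' (hf _ _ xy).
have := vs z x y; rewrite /vstruct zx2 yx (acyclic_asym hD xy) andbF /=.
have zy : z != y by apply: contraTneq zx' => ->; rewrite (acyclic_asym hD xy).
by rewrite zy -sk nzy.
Qed.

(** Each reversal of a covered arc brings [D] one arc closer to [D']. It preserves skeleton and
    v-structures because it preserves the Markov equivalence class. *)
Lemma same_markov_equiv D D' : acyclic D -> acyclic D' ->
  same_skeleton_vstruct D D' -> markov_equiv R D D'.
Proof.
move=> hD hD'; have [n] := ubnP #|D :\: D'|;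
  elim: n D hD => // n IH D hD leD sDD'.
have [DD'|/ex_covered_arc] := eqVneq (D :\: D') set0.
  suff -> : D = D' by move=> T p hp.
  have /subsetP sub : D \subset D' by rewrite -setD_eq0 DD'.
  apply/setP => -[u v]; apply/idP/idP => [/sub //|uv].
  have := sDD'.1 u v; rewrite /adj /= uv => /orP[//|/sub].
  by rewrite (acyclic_asym hD' uv).
case/(_ hD hD' sDD') => x [y [cov nxy yx]].
have hD1 := reverse_arc_acyclic hD cov.
have eq1 := @markov_equiv_reverse_arc R _ D x y hD cov.
have s1 := markov_equiv_same hD hD1 eq1.
have eq2 : markov_equiv R (reverse_arc D x y) D'.
  apply: IH => //; last exact: same_skeleton_vstruct_trans
    (same_skeleton_vstruct_sym s1) sDD'.
  rewrite -ltnS; apply: leq_trans leD; rewrite ltnS; apply: proper_card;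
    apply/properP; split.
    apply/subsetP => e; rewrite !inE => /andP[ne].
    by rewrite ne; case/orP => [/eqP eE|/andP[]//]; rewrite eE yx in ne.
  exists (x, y); first by rewrite inE nxy; case/andP: cov.
  have xNy : x != y by case/andP: cov => + _; apply: contraTneq => ->;
    rewrite acyclic_irr.
  by rewrite !inE eqxx -pair_eqE /= (negPf xNy) !andbF.
move=> T p hp; split=> [/(eq1 T p hp)/(eq2 T p hp)//|/(eq2 T p hp)/(eq1 T p
  hp)//].
Qed.

Lemma in_markov_class D D' : acyclic D ->
  reflect (acyclic D' /\ same_skeleton_vstruct D D') (D' \in markov_class R D).
Proof.
move=> hD; rewrite inE; apply: (iffP andP) => -[hD' /= h]; split=> //.
  by apply: (@markov_equiv_same R) => //; exact/asboolP.
by apply/asboolP/same_markov_equiv.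
Qed.

End Chickering.

(** * Meek's rules and compelled arcs *)

Section Meek.
Context {V : finType} (D : digraph V).
Hypothesis hD : acyclic D.

(* Meek's rules 1 to 3. The side conditions refer to the orientations in D
   instead of to undirected edges, which makes the definition monotone. *)
Inductive meek : V -> V -> Prop :=
| meek_vstruct a b c : vstruct D a b c -> meek a b
| meek_nonadj z a b : meek z a -> (a, b) \in D -> z != b -> ~~ adj D z b ->
    meek a b
| meek_cycle a z b : meek a z -> meek z b -> adj D a b -> meek a b
| meek_diamond a b z1 z2 : (a, b) \in D -> adj D a z1 -> adj D a z2 ->
    meek z1 b -> meek z2 b -> z1 != z2 -> ~~ adj D z1 z2 ->
    ~~ (((z1, a) \in D) && ((z2, a) \in D)) -> meek a b.

(** Soundness of the rules: the opposite orientation would create a cycle or a v-structure absent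
    from [D]. In the diamond, [b -> a] forces [z1 -> a] and [z2 -> a]. *)
Lemma meek_compelled D' a b : acyclic D' -> same_skeleton_vstruct D D' ->
  meek a b -> (a, b) \in D'.
Proof.
move=> hD' [sk vs]; elim=> {a b}.
- by move=> a b c; rewrite vs => /and3P[].
- move=> z a b _ za ab zb nzb; have : adj D a b by rewrite /adj /= ab.
  rewrite sk => /orP[//|ba].
  have := vs z a b; rewrite /vstruct za ba zb -sk nzb => /and3P[_ ba' _].
  by rewrite (acyclic_asym hD ab) in ba'.
- move=> a z b _ az _ zb; rewrite sk => /orP[//|ba].
  by have := acyclic_trans hD' az zb; rewrite ba.
- move=> a b z1 z2 ab az1 az2 _ z1b _ z2b z12 nz12.
  have : adj D a b by rewrite /adj /= ab.
  rewrite sk => /orP[//|ba];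
    have into z : adj D a z -> (z, b) \in D' -> (z, a) \in D'.
    by rewrite sk => /orP[az zb|//]; have := acyclic_trans hD' az zb;
      rewrite ba.
  have := vs z1 a z2; rewrite /vstruct !into // z12 -sk nz12.
  by move=> /and4P[-> ->].
Qed.

Lemma meek_arc a b : meek a b -> (a, b) \in D.
Proof. by apply: meek_compelled => //; split. Qed.

Lemma meek_adj a b : meek a b -> adj D a b.
Proof. by move=> /meek_arc h; rewrite /adj /= h. Qed.

(** By [undirected_essential] below, these are the undirected edges of the essential graph. *)
Definition unoriented : rel V :=
  [rel a b | [&& adj D a b, ~~ `[< meek a b >] & ~~ `[< meek b a >]]].

Lemma unorientedP a b :
  reflect [/\ adj D a b, ~ meek a b & ~ meek b a] (unoriented a b).
Proof.
by apply: (iffP and3P) => -[h1 h2 h3]; split=> //; exact/asboolPn.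
Qed.

Lemma unorientedC a b : unoriented a b = unoriented b a.
Proof. by rewrite /unoriented /= adjC andbA andbAC -andbA. Qed.

Lemma unoriented_neq a b : unoriented a b -> a != b.
Proof. by case/unorientedP=> + _ _; apply: contraTneq => ->;
  rewrite /adj /= orbb acyclic_irr. Qed.

Lemma meek_unoriented_adj a b c : meek a b -> unoriented b c -> adj D a c.
Proof.
move=> ab /unorientedP[bc nbc ncb]; apply: contraT => nac; exfalso.
have ac : a != c by apply: contra_notN ncb => /eqP <-.
case/orP: bc => [bc|cb]; first by apply: nbc; apply: meek_nonadj ab bc ac nac.
apply: ncb; apply: (@meek_vstruct c b a).
by rewrite /vstruct cb (meek_arc ab) eq_sym ac adjC.
Qed.

Lemma vstruct_sym a b c : vstruct D a b c -> vstruct D c b a.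
Proof. by rewrite /vstruct eq_sym adjC => /and4P[-> -> -> ->]. Qed.

Lemma arc_trans a b c : (a, b) \in D -> (b, c) \in D -> adj D a c ->
  (a, c) \in D.
Proof. by move=> ab bc; rewrite /adj /= (acyclic_trans hD ab bc) orbF. Qed.

(** The chain graph property: the ends of an unoriented edge have the same compelled parents.
    Induction on the rank of [b], by cases on the rule that orients [a -> b]; a failure would make
    [a - c] unoriented as well. *)
Lemma meek_unoriented a b c : meek a b -> unoriented b c -> meek a c.
Proof.
have [f hf] := acyclic_topo_rank hD.
have [n] := ubnP (f b); elim: n a b c => // n IH a b c leb ab bc.
have nab' x : meek x b -> ~ meek c x.
  move=> xb cx; have /unorientedP[cb _ ncb] := bc.
  by apply: ncb; apply: meek_cycle cx xb _; rewrite adjC.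
have [//|nac] := pselect (meek a c); exfalso.
have dich x : meek x b -> ~ meek x c -> unoriented x c.
  move=> xb nxc; apply/unorientedP; split=> //; last exact: nab'.
  exact: meek_unoriented_adj xb bc.
have ac := dich _ ab nac; have [adj_bc nbc ncb] := unorientedP _ _ bc.
have adj_ac : adj D a c by case/unorientedP: ac.
case: ab (ab) ac adj_ac nac leb bc nab' dich adj_bc nbc ncb => {a b}
  [a b z vs|z a b za ab0 zb nzb|a z b az zb adj_ab|a b z1 z2 ab0 az1 az2 z1b
    z2b z12 nz12 nz];
  move=> ab ac adj_ac nac leb bc nab' dich adj_bc nbc ncb.
(* V-structure at [b]: [b -> c] would create one at [c], and [c -> b] would be compelled by the
   diamond rule. *)
- have zb : meek z b by apply/meek_vstruct/vstruct_sym/vs.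
  have adj_zc := meek_unoriented_adj zb bc.
  have /and4P[ab0 zb0 az naz] := vs.
  case: (pselect (meek z c)) => [zc|nzc].
    have := meek_unoriented_adj zc (etrans (unorientedC _ _) ac).
    by rewrite adjC (negPf naz).
  have nvs : ~~ (((a, c) \in D) && ((z, c) \in D)).
    apply/negP => /andP[ac0 zc0]; apply: nac; apply: (@meek_vstruct a c z).
    by rewrite /vstruct ac0 zc0 az.
  case/orP: adj_bc => [bc0|cb0].
    by rewrite !(arc_trans _ bc0) in nvs.
  by apply: ncb; apply: meek_diamond cb0 _ _ ab zb az naz nvs; rewrite adjC.
(* Induction at [a] gives [z -> c], which makes [z] adjacent to [b]. *)
- have zc := IH _ _ _ (leq_trans (hf _ _ ab0) leb) za ac.
  have := meek_unoriented_adj zc (etrans (unorientedC _ _) bc).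
  by rewrite (negPf nzb).
(* Either [z -> c] is compelled and the cycle rule applies, or [z - c] is unoriented and induction
   at [z] applies. *)
- have lez : f z < n by apply: leq_trans (hf _ _ (meek_arc zb)) leb.
  case: (pselect (meek z c)) => [zc|nzc]; first exact/nac/(meek_cycle az zc).
  exact/nac/(IH _ _ _ lez az)/dich.
(* Diamond: [z1 -> c] and [z2 -> c] are both compelled or both not. If both, the diamond moves from
   [b] to [c]; if neither, the argument for v-structures applies to [z1] and [z2]. *)
have adj_z1c := meek_unoriented_adj z1b bc.
have adj_z2c := meek_unoriented_adj z2b bc.
have caseE z z' : meek z b -> meek z' b -> ~~ adj D z z' -> meek z c ->
  meek z' c.
  move=> zb z'b nzz' zc; case: (pselect (meek z' c)) => // nz'c.
  have := meek_unoriented_adj zc (etrans (unorientedC _ _) (dich _ z'b nz'c)).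
  by rewrite (negPf nzz').
case: (pselect (meek z1 c \/ meek z2 c)) => [zc|nzc].
  have [z1c z2c] : meek z1 c /\ meek z2 c.
    by case: zc => zc; split=> //; apply: caseE zc => //; rewrite adjC.
  case/orP: adj_ac => [ac0|ca0].
    exact/nac/(meek_diamond ac0 az1 az2 z1c z2c z12 nz12 nz).
  have za z : meek z c -> adj D a z -> (z, a) \in D.
    by move=> /meek_arc zc0 az; apply: arc_trans zc0 ca0 _; rewrite adjC.
  by rewrite !za in nz.
have nz1c : ~ meek z1 c by move=> h; apply: nzc; left.
have nvs : ~~ (((z1, c) \in D) && ((z2, c) \in D)).
  apply/negP => /andP[z1c0 z2c0]; apply: nz1c; apply: (@meek_vstruct z1 c z2).
  by rewrite /vstruct z1c0 z2c0 z12.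
case/orP: adj_bc => [bc0|cb0].
  by rewrite !(arc_trans (meek_arc _) bc0) in nvs.
by apply: ncb; apply: meek_diamond cb0 _ _ z1b z2b z12 nz12 nvs; rewrite adjC.
Qed.

(** Non-adjacent parents would form a v-structure, and a compelled arc between them would extend to
    a compelled arc into [v]. *)
Lemma unoriented_parents_unoriented a b v : (a, v) \in D -> (b, v) \in D ->
  a != b -> unoriented a v -> unoriented b v -> unoriented a b.
Proof.
move=> av bv ab uav ubv; apply/unorientedP.
have [_ nav _] := unorientedP _ _ uav; have [_ nbv _] := unorientedP _ _ ubv.
split.
- apply: contraT => nab; case: nav; apply: (@meek_vstruct a v b).
  by rewrite /vstruct av bv ab.
- by move=> /meek_unoriented/(_ ubv).
- by move=> /meek_unoriented/(_ uav).
Qed.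

End Meek.

(** * Perfect elimination orders *)

Section EliminationOrders.
Context {V : eqType} (H : rel V).
Implicit Types (s t q r : seq V).

Definition seq_clique t := {in t &, forall x y, x != y -> H x y}.

Fixpoint elim_order s : Prop :=
  if s is w :: s' then seq_clique [seq x <- s' | H w x] /\ elim_order s'
  else True.

Lemma seq_clique_sub t t' : {subset t' <= t} -> seq_clique t -> seq_clique t'.
Proof. by move=> sub cl x y /sub xt /sub; apply: cl. Qed.

Lemma seq_clique_elim_order t : seq_clique t -> elim_order t.
Proof.
elim: t => //= w t IH cl; split; last first.
  by apply/IH/(seq_clique_sub _ cl) => x xt; rewrite inE xt orbT.
by apply: seq_clique_sub cl => x; rewrite mem_filter inE => /andP[_ ->];
  rewrite orbT.
Qed.

Lemma elim_order_cat r s s' : elim_order (r ++ s') -> elim_order s ->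
  {in r & s, forall x y, H x y -> y \in s'} -> elim_order (r ++ s).
Proof.
elim: r => //= w r IH [cl eo] eos h; split; last first.
  by apply: IH => // x y xr; apply: h; rewrite inE xr orbT.
apply: seq_clique_sub cl => x; rewrite !mem_filter !mem_cat.
case/andP=> wx; rewrite wx /= => /orP[->//|xs].
by rewrite (h w x) ?orbT // mem_head.
Qed.

(** Orienting every edge towards its earlier vertex therefore creates no v-structure. *)
Lemma elim_order_index s a b c : elim_order s -> a \in s -> c \in s ->
  index b s < index a s -> index b s < index c s -> H b a -> H b c -> a != c ->
  H a c.
Proof.
elim: s => //= w s IH [cl eo]; rewrite !inE ![_ == w]eq_sym.
case: (w =P a) => /= [_ _ _|_ as_]; first by rewrite ltn0.
case: (w =P c) => /= [_ _ _|_ cs]; first by rewrite ltn0.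
have [<-|_] := eqVneq w b; last by rewrite !ltnS; apply: IH.
by move=> _ _ ba bc; apply: cl; rewrite mem_filter ?ba ?bc.
Qed.

(* In terms of chordal graphs: a perfect elimination order can be rearranged so
   that any prescribed clique is eliminated last, in any prescribed order. *)
Lemma elim_order_suffix t q : symmetric H -> elim_order t -> uniq t -> uniq q ->
  {subset q <= t} -> seq_clique q ->
  exists2 r, perm_eq (r ++ q) t & elim_order (r ++ q).
Proof.
move=> symH; elim: t q => [|w t IH] q /=.
  by case: q => [|x q] _ _ _ sub _; [exists [::]|have := sub x (mem_head _ _)].
move=> [clw eo] /andP[wt ut] uq sub clq.
have [wq|wq] := boolP (w \in q); last first.
  have subt : {subset q <= t}.
    move=> x xq; have := sub x xq; rewrite inE => /orP[/eqP xw|//].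
    by rewrite -xw xq in wq.
  have [r per er] := IH q eo ut uq subt clq.
  exists (w :: r); first by rewrite /= perm_cons.
  split=> //; apply: seq_clique_sub clw => x.
  by rewrite !mem_filter (perm_mem per).
(* [q'] consists of neighbours of [w], so it is a clique and induction puts it last in [t].
   Reinserting [w] into its place in [q] is harmless: [N ++ q] is a clique and no vertex of [r] is
   adjacent to [w]. *)
pose N := [seq x <- t | H w x && (x \notin q)].
pose q' := N ++ rem w q.
have nbr x : x \in N ++ q -> x != w -> x \in [seq x <- t | H w x].
  rewrite mem_cat !mem_filter => /orP[/andP[/andP[-> _] ->]//|xq] xw.
  have := sub x xq; rewrite inE (negPf xw) /= => ->.
  by rewrite clq // eq_sym.
have q'E x : (x \in q') = (x \in N ++ q) && (x != w).
  rewrite !mem_cat mem_rem_uniq // inE; case: (boolP (x \in N)) => [|_];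
    last first.
    by rewrite /= andbC.
  by rewrite mem_filter => /andP[_ xt]; apply/esym; apply: contraNneq wt => <-.
have sub' : {subset q' <= [seq x <- t | H w x]}.
  by move=> x; rewrite q'E => /andP[]; apply: nbr.
have uq' : uniq q'.
  rewrite cat_uniq filter_uniq // rem_uniq // andbT /=.
  by apply/hasPn => x /mem_rem xq; rewrite mem_filter xq andbF.
have subt : {subset q' <= t}.
  by move=> x /sub'; rewrite mem_filter => /andP[].
have [r per er] := IH q' eo ut uq' subt (seq_clique_sub sub' clw).
exists (r ++ N); rewrite -catA.
  have : perm_eq (w :: (r ++ N ++ rem w q)) (w :: t) by rewrite perm_cons.
  apply: perm_trans; rewrite !catA -cat1s perm_sym perm_catCA perm_cat2l.
  by rewrite perm_sym perm_to_rem.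
apply: elim_order_cat er _ _.
  apply: seq_clique_elim_order => x y xN yN xy.
  have [xw|xw] := eqVneq x w.
    have := nbr y yN; rewrite -xw eq_sym xy => /(_ isT).
    by rewrite mem_filter => /andP[].
  have [yw|yw] := eqVneq y w.
    have := nbr x xN; rewrite -yw xy => /(_ isT).
    by rewrite mem_filter symH => /andP[].
  by apply: clw => //; apply: nbr.
move=> x y xr yN xy; rewrite q'E yN /=; apply: contraT;
  rewrite negbK => /eqP yw.
have xt : x \in t by rewrite -(perm_mem per) mem_cat xr.
have xw : x != w by apply: contraNneq wt => <-.
have : x \in q'.
  rewrite q'E xw andbT mem_cat mem_filter xt symH -yw xy /=.
  by case: (x \in q).
move=> xq'; have := perm_uniq per;
  rewrite ut cat_uniq => /and3P[_ /hasPn/(_ _ xq')].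
by rewrite /= xr.
Qed.

End EliminationOrders.

(** * Orienting the unoriented edges along an elimination order *)

Section Reorientation.
Context {V : finType} (D : digraph V).
Hypothesis hD : acyclic D.

(** Decreasing topological order works: the later neighbours of a vertex are parents of it, hence
    form a clique. *)
Lemma unoriented_elim_order : exists s,
  [/\ elim_order (unoriented D) s, uniq s & forall v, v \in s].
Proof.
have [f hf] := acyclic_topo_rank hD.
pose e := [rel x y | f y <= f x].
have etr : transitive e by move=> y x z /= yx zy; apply: leq_trans zy yx.
have eto : total e by move=> x y; rewrite /= leq_total.
exists (sort e (enum V)); split; last 2 first.
- by rewrite sort_uniq enum_uniq.
- by move=> v; rewrite mem_sort mem_enum.
have := sort_sorted eto (enum V).
elim: (sort e (enum V)) => //= w s IH; rewrite (path_sortedE etr).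
move=> /andP[/allP lew /IH eo]; split=> // x y.
have into z : z \in s -> unoriented D w z -> (z, w) \in D.
  move=> /lew /= zw /unorientedP[/orP[/hf|//]]; by rewrite ltnNge zw.
rewrite !mem_filter => /andP[wx xs] /andP[wy ys] xy.
apply: (unoriented_parents_unoriented hD (into x xs wx) (into y ys wy) xy);
  by rewrite unorientedC.
Qed.

Definition orient (s : seq V) : digraph V :=
  [set e | `[< meek D e.1 e.2 >] ||
           unoriented D e.1 e.2 && (index e.2 s < index e.1 s)].

Lemma in_orient s a b : ((a, b) \in orient s) =
  `[< meek D a b >] || unoriented D a b && (index b s < index a s).
Proof. by rewrite inE. Qed.

(** The rank is lexicographic. Its first component [h] depends only on the compelled parents, so it
    is constant along unoriented edges, and it grows along compelled arcs; the position in [s]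
    decides the rest. *)
Lemma orient_acyclic s : acyclic (orient s).
Proof.
have [f hf] := acyclic_topo_rank hD.
pose h v := \max_(p | `[< meek D p v >]) (f p).+1.
apply: (@topo_rank_acyclic _ _
  (fun v => h v * (size s).+1 + (size s - index v s))) => u v.
have les w : size s - index w s < (size s).+1 by rewrite ltnS leq_subr.
rewrite in_orient => /orP[/asboolP uv|/andP[uv lt]].
  have : h u < h v.
    have le1 : h u <= f u.
      by apply/bigmax_leqP => p /asboolP/(meek_arc hD)/hf.
    apply: leq_ltn_trans le1 _.
    by apply: (@leq_bigmax_cond _ _ (fun p => (f p).+1)); apply/asboolP.
  by have := les u; have := les v; nia.
have -> : h u = h v.
  apply: eq_bigl => p; apply/asboolP/asboolP => /(meek_unoriented hD);
    apply=> //.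
  by rewrite unorientedC.
by rewrite ltn_add2l ltn_sub2l // (leq_trans lt) // index_size.
Qed.

(** Two arcs into [b] from non-adjacent vertices cannot both be unoriented edges, by the elimination
    order, nor be of different kinds, by [meek_unoriented_adj]; so both are compelled and lie in
    [D]. *)
Lemma orient_same s : elim_order (unoriented D) s -> (forall v, v \in s) ->
  same_skeleton_vstruct D (orient s).
Proof.
move=> eo alls.
have adjE i j : adj D i j = adj (orient s) i j.
  rewrite /adj /= !in_orient; apply/idP/idP.
    move=> ij; case: asboolP => //= nij; case: asboolP => //= nji;
      first by rewrite orbT.
    have uij : unoriented D i j by apply/unorientedP.
    rewrite uij unorientedC uij /= -neq_ltn.
    apply: contra_neq (unoriented_neq hD uij) => E.
    by rewrite -(nth_index i (alls i)) -E nth_index.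
  case/orP => /orP[/asboolP/(meek_adj hD)|/andP[/unorientedP[]]] //.
    by rewrite -/(adj D j i) adjC.
  by rewrite -/(adj D j i) adjC.
split=> // a b c; apply/idP/idP.
  move=> vs; have vs' := vstruct_sym vs; move: (vs) => /and4P[_ _ ac nac].
  rewrite /vstruct -adjE ac nac !in_orient /= andbT; apply/andP.
  by split; apply/orP; left; apply/asboolP;
    [apply: meek_vstruct vs|apply: meek_vstruct vs'].
rewrite /vstruct -adjE !in_orient => /and4P[ab cb ac nac];
  rewrite ac nac !andbT.
case/orP: ab => [/asboolP ab|/andP[uab lab]].
  case/orP: cb => [/asboolP cb|/andP[ucb _]]; first by rewrite !(meek_arc hD).
  have := meek_unoriented_adj hD ab (etrans (unorientedC _ _ _) ucb).
  by rewrite (negPf nac).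
case/orP: cb => [/asboolP cb|/andP[ucb lcb]].
  have := meek_unoriented_adj hD cb (etrans (unorientedC _ _ _) uab).
  by rewrite adjC (negPf nac).
have := elim_order_index eo (alls a) (alls c) lab lcb.
rewrite unorientedC uab unorientedC ucb => /(_ isT isT ac) /unorientedP[].
by rewrite (negPf nac).
Qed.

Lemma unoriented_orientable a b : unoriented D a b -> exists D',
  [/\ acyclic D', same_skeleton_vstruct D D' & (a, b) \in D'].
Proof.
move=> uab; have [t [eo ut allt]] := unoriented_elim_order.
have ab := unoriented_neq hD uab.
(* [b] precedes [a], since [orient] points to the earlier vertex. *)
have [||||r per er] := @elim_order_suffix _ (unoriented D) t [:: b; a] _ eo ut.
- by move=> x y; rewrite unorientedC.
- by rewrite /= inE eq_sym ab.
- by move=> x _; apply: allt.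
- move=> x y; rewrite !inE => /orP[]/eqP-> /orP[]/eqP->; rewrite ?eqxx //.
  by rewrite unorientedC.
have us : uniq (r ++ [:: b; a]) by rewrite (perm_uniq per).
exists (orient (r ++ [:: b; a])); split; first exact: orient_acyclic.
  by apply: orient_same => // v; rewrite (perm_mem per).
rewrite in_orient uab /= !index_cat.
have := us; rewrite cat_uniq => /and3P[_ /hasPn h _].
rewrite (negPf (h b _)) ?(negPf (h a _)) ?inE ?eqxx ?orbT //=.
by rewrite eqxx eq_sym (negPf ab) eqxx addn0 -addn1 leq_add2l ltn0Sn orbT.
Qed.

Lemma undirected_essential (R : realType) i j :
  undirected_adj (essential_graph R D) i j = unoriented D i j.
Proof.
rewrite /undirected_adj /= !inE /= [((j, i) \in D) || _]orbC.
rewrite -[_ || _]/(adj D i j).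
have notall a b : unoriented D a b ->
    [forall D' in markov_class R D, (b, a) \in D'] = false.
  move=> /unoriented_orientable[D' [hD' s ab]]; apply/negbTE/forall_inPn.
  by exists D'; [exact/in_markov_class|rewrite (acyclic_asym hD' ab)].
apply/and3P/idP => [[ij nij nji]|uij].
  rewrite ij /= in nij nji; apply/unorientedP; split=> // m.
    by case/negP: nij; apply/forall_inP => D' /(in_markov_class R _ hD)[? ?];
      apply: meek_compelled m.
  by case/negP: nji; apply/forall_inP => D' /(in_markov_class R _ hD)[? ?];
    apply: meek_compelled m.
have [ij _ _] := unorientedP _ _ _ uij.
by rewrite ij !notall // unorientedC.
Qed.

End Reorientation.

(** * Verifying sets *)

Section Verification.
Context (R : realType) {V : finType} (D : digraph V).
Hypothesis hD : acyclic D.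

Local Notation und := (unoriented D).

Lemma verifying_covers (I : {set V}) x y : verifying R D I -> covered D x y ->
  (x \in I) || (y \in I).
Proof.
move=> vI cov; apply: contraT; rewrite negb_or => /andP[xI yI].
have xy : (x, y) \in D by case/andP: cov.
have xNy : x != y by apply: contraTneq xy => ->; rewrite acyclic_irr.
have /setP/(_ (x, y)) := congr1 (@directed V) vI.
rewrite /= xy !inE => /andP[_ /forall_inP/(_ (reverse_arc D x y))].
rewrite in_reverse_arc !eqxx (negPf xNy) /=; apply; rewrite inE.
apply/andP; split.
  rewrite inE reverse_arc_acyclic //=; apply/asboolP.
  exact: markov_equiv_reverse_arc.
apply/forallP => -[u v] /=; apply/implyP => uvI.
rewrite in_reverse_arc; apply/eqP.
have [ux|ux] := eqVneq u x; have [uy|uy] := eqVneq u y;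
  have [vx|vx] := eqVneq v x; have [vy|vy] := eqVneq v y => //=;
  by move: uvI; rewrite ?ux ?uy ?vx ?vy ?(negPf xI) ?(negPf yI).
Qed.

Definition und_parents v := [set u | ((u, v) \in D) && und u v].

Lemma arc_unoriented_or_meek a b : (a, b) \in D -> und a b \/ meek D a b.
Proof.
move=> ab; have [m|nm] := pselect (meek D a b); [by right|left].
apply/unorientedP; split=> //; first by rewrite /adj /= ab.
by move=> /(meek_arc hD); rewrite (acyclic_asym hD ab).
Qed.

(** By [meek_unoriented], [q] and [v] have the same compelled parents, so only the undirected
    parents matter. *)
Lemma und_parent_covered q v : q \in und_parents v ->
  und_parents v = q |: und_parents q -> covered D q v.
Proof.
rewrite inE => /andP[qv uqv] /setP E; rewrite /covered qv /=.
have uvq : und v q by rewrite unorientedC.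
apply/eqP/setP => z; rewrite !inE.
have [->|zq] := eqVneq z q; first by rewrite qv.
have := E z; rewrite !inE (negPf zq) /= => {}E; apply/idP/idP => h.
  case: (arc_unoriented_or_meek h) =>
    [u|/(meek_unoriented hD)/(_ uvq)/(meek_arc hD)//].
  by move: E; rewrite h u /= => /esym/andP[].
case: (arc_unoriented_or_meek h) =>
  [u|/(meek_unoriented hD)/(_ uqv)/(meek_arc hD)//].
by move: E; rewrite h u /= => /andP[].
Qed.

(** [q] has maximal rank. The undirected parents of [v] form a clique, so the others are joined to
    [q] and point into it. *)
Lemma last_und_parent v : und_parents v != set0 ->
  exists2 q, q \in und_parents v & und_parents v \subset q |: und_parents q.
Proof.
have [f hf] := acyclic_topo_rank hD; move=> /set0Pn[q0 q0v].
case: (@arg_maxnP _ q0 (mem (und_parents v)) f q0v) => q /= qv maxq;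
  exists q => //.
apply/subsetP => z zv; move: (zv) (qv);
  rewrite !inE => /andP[zv' uzv] /andP[qv' uqv].
have [//|zq /=] := eqVneq z q.
have uzq := unoriented_parents_unoriented hD zv' qv' zq uzv uqv.
rewrite uzq andbT; have [/orP[//|/hf]] := unorientedP _ _ _ uzq.
by have := maxq z zv; rewrite /= leqNgt => /negP.
Qed.

(* Walk up from v through last undirected parents. Along a step from q to v the
   number of undirected parents grows by at most one, and when it does grow the
   arc is covered, hence has an endpoint in I; each element of I on the walk
   accounts for at most two such steps. *)
Lemma card_und_parents (I : {set V}) v : verifying R D I ->
  exists2 J : {set V}, J \subset I :&: [set w | connect und v w] &
    #|und_parents v| + (v \in I) <= 2 * #|J|.
Proof.
move=> vI; have [f hf] := acyclic_topo_rank hD.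
(* The bound on ranks in [J] ensures that the next vertex of the walk is not yet in [J]. *)
suff [J [/subsetP JI Jv _ le]] : exists J : {set V}, [/\ J \subset I,
    {in J, forall w, connect und v w}, {in J, forall w, f w <= f v} &
    #|und_parents v| + (v \in I) <= 2 * #|J|].
  by exists J => //; apply/subsetP => w wJ; rewrite !inE JI ?Jv.
have cardI w : #|[set w] :&: I| = (w \in I).
  case: (boolP (w \in I)) => wI; first by rewrite (setIidPl _) ?cards1 ?sub1set.
  apply/eqP; rewrite cards_eq0 -subset0; apply/subsetP => z; rewrite !inE.
  by case: eqP => // ->; rewrite (negPf wI).
have [n] := ubnP (f v); elim: n v => // n IH v lev.
have [->|/last_und_parent[q qv sub]] := eqVneq (und_parents v) set0.
  exists ([set v] :&: I); rewrite subsetIr cards0 cardI; split=> //.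
  - by move=> w; rewrite !inE => /andP[/eqP-> _].
  - by move=> w; rewrite !inE => /andP[/eqP-> _].
  - by rewrite mul2n -addnn leq_addr.
have [qv' uqv] : (q, v) \in D /\ und q v by move: qv; rewrite inE => /andP.
have [J [JI Jq leJ le]] := IH q (leq_trans (hf _ _ qv') lev).
exists (J :|: [set v] :&: I).
have disj : [disjoint J & [set v] :&: I].
  rewrite disjoint_subset; apply/subsetP => w /leJ wq; rewrite !inE.
  by apply: contraL (hf _ _ qv') => /andP[/eqP<- _]; rewrite -leqNgt.
have cJ : #|J :|: [set v] :&: I| = #|J| + (v \in I).
  by apply/eqP; rewrite -cardI (leq_card_setU _ _).2.
rewrite cJ; split.
- by rewrite subUset JI subsetIr.
- move=> w; rewrite !inE => /orP[/Jq qw|/andP[/eqP-> _]]; last exact: connect0.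
  by apply: connect_trans (connect1 _) qw; rewrite unorientedC.
- move=> w; rewrite !inE => /orP[/leJ wq|/andP[/eqP-> _]] //.
  exact: leq_trans wq (ltnW (hf _ _ qv')).
have cU : #|q |: und_parents q| <= #|und_parents q|.+1.
  by rewrite cardsU1; case: (q \notin _).
(* If [v] is in [I], it pays for this step and keeps a unit, recorded by the term [(v \in I)]. If
   only [q] is, its spare unit pays; if neither is, the arc is not covered and the count does not
   grow. *)
case: (boolP (v \in I)) => vinI; first by have := subset_leq_card sub; lia.
case: (boolP (q \in I)) => qinI.
  by have := subset_leq_card sub; rewrite qinI in le; lia.
have : und_parents v \proper q |: und_parents q.
  rewrite properEneq sub andbT;
    apply: contraNneq vinI => /(und_parent_covered qv).
  by move=> /(verifying_covers vI); rewrite (negPf qinI).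
by move=> /proper_card; lia.
Qed.

(** All vertices of [K] but the last one, [v], are undirected parents of [v]. *)
Lemma clique_le_verifying (I K : {set V}) x : verifying R D I ->
  K \subset [set y | connect und x y] -> clique und K ->
  #|K| <= (2 * #|I :&: [set y | connect und x y]|).+1.
Proof.
move=> vI /subsetP KG /forall_inP clK; have [f hf] := acyclic_topo_rank hD.
have [->|/set0Pn[v0 v0K]] := eqVneq K set0; first by rewrite cards0.
case: (@arg_maxnP _ v0 (mem K) f v0K) => v /= vK maxv.
have [J JI le] := card_und_parents v vI.
have sub : K \subset v |: und_parents v.
  apply/subsetP => w wK; rewrite !inE; have [//|wv /=] := eqVneq w v.
  have /forall_inP/(_ v vK) := clK w wK; rewrite wv /= => uwv;
    rewrite uwv andbT.
  have [/orP[//|/hf]] := unorientedP _ _ _ uwv.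
  by have := maxv w wK; rewrite /= leqNgt => /negP.
have : #|J| <= #|I :&: [set y | connect und x y]|.
  apply: subset_leq_card; apply: subset_trans JI _; apply/subsetP => w.
  rewrite !inE => /andP[-> vw] /=; apply: connect_trans vw.
  by have := KG v vK; rewrite inE.
by have := subset_leq_card sub; rewrite cardsU1; case: (_ \notin _); lia.
Qed.

End Verification.

Theorem theorem2 (R : realType) (V : finType) (D : digraph V)
    (hD : acyclic D) :
  (min_verifying_size R D >=
     \sum_(G in chain_components (essential_graph R D))
        clique_number (undirected_adj (essential_graph R D)) G %/ 2)%N.
Proof.
have [[I vI <-] _] := min_verifying_sizeP R hD.
have undE : undirected_adj (essential_graph R D) =2 unoriented D.
  by move=> i j; apply: undirected_essential.
have conE := eq_connect undE.
have part : partition (chain_components (essential_graph R D)) [set: V].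
  apply: equivalence_partitionP => x y z _ _ _; split; first exact: connect0.
  move=> xy; apply: same_connect xy _; apply: sym_connect_sym => i j.
  by rewrite !undE unorientedC.
(* The chain components partition the vertices, so [I] splits into its traces on them. *)
apply: (@leq_trans (\sum_(G in chain_components (essential_graph R D))
    #|I :&: G|)); last first.
  under eq_bigr => G _ do rewrite -sum1_card.
  under eq_bigr => G _.
    rewrite (eq_bigl (fun x => (x \in G) && (x \in I))) => [|x];
      last by rewrite inE andbC.
    rewrite big_mkcondr; over.
  rewrite -(set_partition_big _ part) -big_mkcondr -[leqRHS]sum1_card.
  by rewrite (eq_bigl (mem I)) // => x; rewrite inE.
apply: leq_sum => G /imsetP[x _ ->].
rewrite (_ : [set _ in _ | _] = [set y | connect (unoriented D) x y]);
  last first.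
  by apply/setP => y; rewrite !inE conE.
(* With [m] the size of the trace, a clique number of at most [2m + 1] is below [2(m + 1)], so half
   of it rounds down to at most [m]. *)
rewrite -ltnS ltn_divLR // mulSn mulnC;
  apply: (@leq_ltn_trans (2 * #|I :&: [set y | connect (unoriented D) x
  y]|).+1); last by lia.
apply/bigmax_leqP => K /andP[KG /forall_inP clK].
apply: clique_le_verifying vI KG _ => //; rewrite /clique.
apply/forall_inP => i iK; apply/forall_inP => j jK; rewrite -undE.
by have /forall_inP/(_ j jK) := clK i iK.
Qed.
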